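(* Let $n$ be a positive integer, let $r$ be the positive integer with $\binom{r}{2} \leq n < \binom{r+1}{2}$, and set $t := n - \binom{r}{2}$. Then every graph $\mathcal{G}$ with exactly $n$ edges has at most $\binom{r}{3} + \binom{t}{2}$ triangles. Furthermore, for each such $n$ there exists a graph with exactly $n$ edges that has exactly $\binom{r}{3}+\binom{t}{2}$ triangles.
   Context: Graphs are finite, simple, loopless and undirected. A triangle of a graph is a set of three pairwise adjacent vertices. Binomial coefficients $\binom{a}{b}$ with $0 \le a < b$ are $0$. *)

(* Defs.v *)
From mathcomp Require Import all_boot.

Set Implicit Arguments.
Unset Strict Implicit.
Unset Printing Implicit Defensive.

Record sgraph (T : finType) := SGraph {
  adj : rel T;
  adj_sym : symmetric adj;
  adj_irrefl : irreflexive adj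
}.

(* An edge is the unordered pair of its two endpoints, so each edge is counted
   once although [adj] relates its endpoints in both directions. *)
Definition edges (T : finType) (G : sgraph T) : {set {set T}} :=
  [set [set p.1; p.2] | p : T * T & adj G p.1 p.2].

Definition triangles (T : finType) (G : sgraph T) : {set {set T}} :=
  [set A : {set T} | (#|A| == 3) &&
     [forall x in A, forall y in A, (x != y) ==> adj G x y]].

(* Main.v *)
Require Import Defs.
From mathcomp Require Import all_boot.
From mathcomp Require Import zify.

Set Implicit Arguments.
Unset Strict Implicit.
Unset Printing Implicit Defensive.

(** The upper bound is proved by deleting a vertex [v] of least positive degree
    [d].  The triangles through [v] correspond to the edges inside the
    neighbourhood of [v], of which there are at most ['C(d, 2)], so [G] has at
    most ['C(d, 2)] more triangles than [G - v], a graph with [d] fewer edges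
    ([card_edges_del], [card_triangles_del]).

    Call [f m] the claimed maximum for [m] edges.  The successive differences of
    [f] are the blocks 0 | 0, 1 | 0, 1, 2 | ..., the block of [r] starting at
    [m = 'C(r, 2)].  What has to be shown is that the [d] differences just before
    [n] add up to at least ['C(d, 2)] = 0 + 1 + ... + (d - 1).  As [v] and its
    [d] neighbours all have degree at least [d], counting degrees gives
    ['C(d.+1, 2) <= n], whence [d < r].  Hence these [d] differences lie in at
    most two consecutive blocks, and the inequality is the convexity of
    ['C(-, 2)] ([bin2_convex]) whether [n - d] falls in the block of [n] or in
    the previous one.

    Equality holds for the complete graph on [r] vertices together with one more
    vertex joined to [t] of them; the two deletion formulas, applied to that
    vertex, count its edges and triangles. *)

(** * Edges and triangles of a graph *)

Section Graph.

Variables (T : finType) (G : sgraph T).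
Implicit Types (v x y : T) (e A : {set T}).

Definition nbhd v : {set T} := [set y | adj G v y].

Lemma edgesP e :
  reflect (exists x y, adj G x y /\ e = [set x; y]) (e \in edges G).
Proof.
apply: (iffP imsetP) => [[[x y]]|[x [y [xy ->]]]]; last by exists (x, y); rewrite ?inE.
by rewrite inE => xy ->; exists x, y.
Qed.

Lemma adj_neq x y : adj G x y -> x != y.
Proof. by apply: contraTneq => ->; rewrite adj_irrefl. Qed.

Lemma mem_edges x y : ([set x; y] \in edges G) = adj G x y.
Proof.
apply/edgesP/idP => [[a [b [ab E]]]|xy]; last by exists x, y.
move: ab (adj_neq ab).
have : (a \in [set x; y]) && (b \in [set x; y]) by rewrite E set21 set22.
rewrite !inE => /andP[].
by do 2![case/orP=> /eqP->]; rewrite ?eqxx // adj_sym.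
Qed.

Lemma card_edge e : e \in edges G -> #|e| = 2.
Proof. by case/edgesP=> x [y [/adj_neq xy ->]]; rewrite cards2 xy. Qed.

Lemma trianglesP A :
  reflect (#|A| = 3 /\ {in A &, forall x y, x != y -> adj G x y})
          (A \in triangles G).
Proof.
rewrite inE; apply: (iffP andP) => [[/eqP A3 H]|[/eqP A3 H]]; split=> //.
  move=> x y xA yA xy.
  by move/forall_inP: H => /(_ x xA) /forall_inP /(_ y yA) /implyP; apply.
apply/forall_inP=> x xA; apply/forall_inP=> y yA; apply/implyP; exact: H.
Qed.

Lemma nbhd_irrefl v : v \notin nbhd v.
Proof. by rewrite inE adj_irrefl. Qed.

(** Edges at [v] and neighbours of [v] are in bijection by [y |-> {v, y}]. *)
Lemma card_edges_at v : #|edges G :&: [set e : {set T} | v \in e]| = #|nbhd v|.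
Proof.
have inj : {in nbhd v &, injective (fun y => [set v; y])}.
  move=> x y; rewrite !inE => /adj_neq vx _ /setP/(_ x).
  by rewrite !inE eqxx orbT eq_sym (negbTE vx) => /esym/eqP.
rewrite -(card_in_imset inj); apply: eq_card => e; rewrite !inE.
apply/andP/imsetP => [[/edgesP[x [y [xy ->]]]]|[y]].
  rewrite !inE => /orP[]/eqP->; first by exists y; rewrite ?inE.
  by exists x; rewrite ?inE 1?adj_sym // setUC.
by rewrite inE => vy ->; rewrite mem_edges vy set21.
Qed.

Lemma handshake : \sum_v #|nbhd v| = 2 * #|edges G|.
Proof.
transitivity (\sum_v \sum_(e in edges G) (v \in e : nat)).
  apply: eq_bigr => v _; rewrite -card_edges_at -sum1_card big_mkcond /=.
  rewrite [RHS]big_mkcond /=; apply: eq_bigr => e _; rewrite !inE.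
  by case: (e \in edges G); case: (v \in e).
rewrite exchange_big /= mulnC -sum_nat_const; apply: eq_bigr => e /card_edge <-.
by rewrite -sum1_card [RHS]big_mkcond; apply: eq_bigr => v _; case: (v \in e).
Qed.

(** A vertex [v] of least positive degree [d] works: [v] and its neighbours are
    [d.+1] vertices of degree at least [d], so the degrees sum to at least
    [d.+1 * d]. *)
Lemma small_degree_vertex :
  edges G != set0 ->
  exists2 v, 0 < #|nbhd v| & 'C(#|nbhd v|.+1, 2) <= #|edges G|.
Proof.
case/set0Pn=> _ /edgesP[x [y [xy _]]].
have x_gt0 : 0 < #|nbhd x| by apply/card_gt0P; exists y; rewrite inE.
case: (@arg_minnP _ x (fun v => 0 < #|nbhd v|) (fun v => #|nbhd v|) x_gt0).
move=> v v_gt0 v_min; exists v => //.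
suff : #|nbhd v|.+1 * #|nbhd v| <= 2 * #|edges G|.
  by rewrite bin2 /=; lia.
have -> : #|nbhd v|.+1 = #|v |: nbhd v| by rewrite cardsU1 nbhd_irrefl.
rewrite -handshake -sum_nat_const [leqRHS](bigID (mem (v |: nbhd v))) /=.
apply: leq_trans (leq_addr _ _); apply: leq_sum => u.
rewrite !inE => /orP[/eqP->//|vu]; apply: v_min.
by apply/card_gt0P; exists v; rewrite inE adj_sym.
Qed.

Lemma triangles_set0 : edges G = set0 -> triangles G = set0.
Proof.
move=> E0; apply/setP=> A; rewrite in_set0; apply/trianglesP=> -[A3 H].
have /card_gt1P[x [y [xA yA xy]]] : 1 < #|A| by rewrite A3.
by have := H _ _ xA yA xy; rewrite -mem_edges E0 inE.
Qed.

End Graph.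

(** * Deleting a vertex *)

Section Deletion.

Variables (T : finType) (G : sgraph T) (v : T).

Definition del_adj x y := [&& adj G x y, x != v & y != v].

Fact del_adj_sym : symmetric del_adj.
Proof. by move=> x y; rewrite /del_adj adj_sym [(x != v) && _]andbC. Qed.

Fact del_adj_irrefl : irreflexive del_adj.
Proof. by move=> x; rewrite /del_adj adj_irrefl. Qed.

(** [v] is kept as an isolated vertex, which avoids a change of vertex type. *)
Definition del_vertex : sgraph T := SGraph del_adj_sym del_adj_irrefl.

Lemma edges_del : edges del_vertex = edges G :\: [set e : {set T} | v \in e].
Proof.
apply/setP=> e; rewrite !inE; apply/edgesP/andP.
  case=> x [y [/and3P[xy xv yv] ->]]; rewrite mem_edges xy !inE.
  by rewrite negb_or ![v == _]eq_sym xv yv.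
case=> ve /edgesP[x [y [xy E]]]; exists x, y; split=> //.
move: ve; rewrite E !inE negb_or ![v == _]eq_sym => /andP[xv yv].
exact/and3P.
Qed.

Lemma card_edges_del : #|edges G| = #|edges del_vertex| + #|nbhd G v|.
Proof. by rewrite edges_del -card_edges_at addnC cardsID. Qed.

Lemma triangles_del : triangles del_vertex = triangles G :\: [set A : {set T} | v \in A].
Proof.
apply/setP=> A; apply/trianglesP/setDP.
  case=> A3 H; split.
    by apply/trianglesP; split=> // x y xA yA /(H x y xA yA)/and3P[].
  (* [v] is isolated after the deletion, so no triangle contains it *)
  rewrite inE; apply/negP=> vA; have /card_gt0P[x] : 0 < #|A :\ v|.
    by have := cardsD1 v A; rewrite A3 vA; lia.
  by rewrite !inE => /andP[xv xA]; have /and3P[] := H _ _ xA vA xv; rewrite eqxx.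
case=> /trianglesP[A3 H]; rewrite inE => vA; split=> // x y xA yA xy.
apply/and3P; split; first exact: H.
- by apply: contraNneq vA => <-.
- by apply: contraNneq vA => <-.
Qed.

(** The bijection sends an edge [e] inside the neighbourhood of [v] to
    [v |: e]. *)
Lemma card_triangles_at :
  #|triangles G :&: [set A : {set T} | v \in A]| =
  #|[set e in edges G | e \subset nbhd G v]|.
Proof.
set E := [set e in _ | _].
have vE e : e \in E -> v \notin e.
  by rewrite inE => /andP[_ /subsetP eN]; apply: contra (nbhd_irrefl G v) => /eN.
have inj : {in E &, injective (fun e => v |: e)}.
  by move=> e e' /vE ve /vE ve' /(congr1 (fun A => A :\ v)); rewrite !setU1K.
rewrite -(card_in_imset inj); apply: eq_card => A.
apply/setIP/imsetP => [[/trianglesP[A3 H]]|[e eE ->]].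
  rewrite inE => vA.
  exists (A :\ v); last by rewrite setD1K.
  have /cards2P[x [y [xy Exy]]] : #|A :\ v| == 2.
    by have := cardsD1 v A; rewrite A3 vA; lia.
  have Av z : z \in [set x; y] -> z != v /\ z \in A.
    by rewrite -Exy !inE => /andP[].
  have [[xv xA] [yv yA]] := (Av x (set21 _ _), Av y (set22 _ _)).
  rewrite inE Exy mem_edges H //=; apply/subsetP=> z /Av[zv zA].
  by rewrite inE H // eq_sym.
split; last by rewrite inE setU11.
have ve := vE e eE.
move: eE; rewrite inE => /andP[eG /subsetP eN].
apply/trianglesP; split; first by rewrite cardsU1 ve (card_edge eG).
case/edgesP: eG eN ve => a [b [ab ->]] eN _ x y.
have va : adj G v a by have := eN a (set21 _ _); rewrite inE.
have vb : adj G v b by have := eN b (set22 _ _); rewrite inE.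
rewrite !inE => /or3P[]/eqP-> /or3P[]/eqP->; rewrite ?eqxx //.
all: by rewrite // adj_sym.
Qed.

Lemma card_triangles_del :
  #|triangles G| =
  #|triangles del_vertex| + #|[set e in edges G | e \subset nbhd G v]|.
Proof. by rewrite triangles_del -card_triangles_at addnC cardsID. Qed.

Lemma card_edges_nbhd :
  #|[set e in edges G | e \subset nbhd G v]| <= 'C(#|nbhd G v|, 2).
Proof.
rewrite -cards_draws; apply/subset_leq_card/subsetP=> e.
by rewrite !inE => /andP[/card_edge-> ->].
Qed.

End Deletion.

(** * The upper bound *)

(** Convexity of ['C(-, 2)]: among pairs with a given sum, the pair that is
    further apart has the larger value. *)
Lemma bin2_convex s t d : t <= d <= s ->
  'C(s + t - d, 2) + 'C(d, 2) <= 'C(s, 2) + 'C(t, 2).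
Proof.
case/andP=> /subnKC <- /subnKC <-; move: (d - t) (s - _) => x y.
have -> : t + x + y + t - (t + x) = t + y by lia.
elim: x => [|x IHx]; first by rewrite addn0.
by rewrite !(addnS, addSn) !binS !bin1; lia.
Qed.

(** Indexing by [r] and [t] lets the induction on the number of edges pass to
    the pair that belongs to [n - d] without computing it from [n - d]. *)
Lemma leq_card_triangles (T : finType) (G : sgraph T) r t :
  t < r -> #|edges G| = 'C(r, 2) + t -> #|triangles G| <= 'C(r, 3) + 'C(t, 2).
Proof.
have [m] := ubnP #|edges G|.
elim: m G r t => // m IHm G r t /ltnSE-ltGm t_lt_r cardG.
have [/triangles_set0->|/small_degree_vertex[v d_gt0 d_small]] :=
  eqVneq (edges G) set0; first by rewrite cards0.
have edges_d := card_edges_del G v.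
rewrite (card_triangles_del G v).
apply: leq_trans (leq_add (leqnn _) (card_edges_nbhd G v)) _.
set d := #|nbhd G v| in d_gt0 d_small edges_d *.
have d_lt_r : d < r.
  rewrite ltnNge; apply/negP=> r_le_d.
  have : 'C(r.+1, 2) <= 'C(d.+1, 2) by apply: leq_bin2l.
  by rewrite [in leqLHS]binS bin1; lia.
have [d_le_t|t_lt_d] := leqP d t.
  (* [n - d] stays in the block of [r]; convexity is used between the pairs
     [(t - d, d)] and [(t, 0)] *)
  have := @IHm (del_vertex G v) r (t - d).
  have := @bin2_convex t 0 d; rewrite addn0 bin0n d_le_t.
  by lia.
(* with [r = s.+1], [n - d] lies in the block of [s], at position
   [s + t - d < s] *)
case: r => // s in t_lt_r cardG d_lt_r *.
have := @IHm (del_vertex G v) s (s + t - d).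
have := @bin2_convex s t d; rewrite (ltnW t_lt_d) -ltnS d_lt_r.
move: cardG; rewrite !binS bin1.
by lia.
Qed.

(** * The extremal graph *)

Section Extremal.

Variables r t : nat.

Definition quasi_clique_adj (x y : option 'I_r) : bool :=
  match x, y with
  | Some i, Some j => i != j
  | Some i, None | None, Some i => i < t
  | None, None => false
  end.

Fact quasi_clique_sym : symmetric quasi_clique_adj.
Proof. by move=> [i|] [j|] //=; rewrite eq_sym. Qed.

Fact quasi_clique_irrefl : irreflexive quasi_clique_adj.
Proof. by move=> [i|] //=; rewrite eqxx. Qed.

Definition quasi_clique : sgraph (option 'I_r) :=
  SGraph quasi_clique_sym quasi_clique_irrefl.

Let K := del_vertex quasi_clique None.

Lemma adj_quasi_clique_del x y :
  adj K x y = [&& x != y, x != None & y != None].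
Proof. by case: x y => [i|] [j|] //=; rewrite /del_adj /= ?andbF. Qed.

Lemma card_some : #|~: [set None : option 'I_r]| = r.
Proof. by rewrite cardsC1 card_option card_ord. Qed.

Lemma card_edges_clique : #|edges K| = 'C(r, 2).
Proof.
rewrite -[in RHS]card_some -cards_draws; apply: eq_card => e; rewrite inE.
apply/edgesP/andP => [[x [y []]]|[eN /cards2P[x [y [xy E]]]]].
  rewrite adj_quasi_clique_del => /and3P[xy xN yN] ->.
  by rewrite cards2 xy subUset !sub1set !inE xN yN.
exists x, y; split=> //; rewrite adj_quasi_clique_del xy.
by move: eN; rewrite E subUset !sub1set !inE.
Qed.

Lemma card_triangles_clique : #|triangles K| = 'C(r, 3).
Proof.
rewrite -[in RHS]card_some -cards_draws triangles_del; apply: eq_card => A.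
rewrite in_setD !in_set; have -> : (A \subset ~: [set None]) = (None \notin A).
  by rewrite subsetC sub1set inE.
case NA: (None \in A) => //=; case: eqP => //= A3.
apply/forall_inP=> x xA; apply/forall_inP=> y yA; apply/implyP.
by case: x xA => [i|]; case: y yA => [j|]; rewrite ?NA.
Qed.

Hypothesis t_le_r : t <= r.

Lemma card_nbhd_quasi_clique : #|nbhd quasi_clique None| = t.
Proof.
have inj : injective (fun i : 'I_t => Some (widen_ord t_le_r i)).
  by move=> i j [/val_inj].
rewrite -[RHS]card_ord -(card_imset _ inj); apply: eq_card => x; rewrite inE.
apply/idP/imsetP => [|[i _ ->]]; last by rewrite /= ltn_ord.
case: x => //= i it; exists (Ordinal it) => //.
by congr Some; apply: val_inj.
Qed.

Lemma card_edges_quasi_clique : #|edges quasi_clique| = 'C(r, 2) + t.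
Proof.
by rewrite (card_edges_del _ None) card_edges_clique card_nbhd_quasi_clique.
Qed.

Lemma card_triangles_quasi_clique :
  #|triangles quasi_clique| = 'C(r, 3) + 'C(t, 2).
Proof.
rewrite (card_triangles_del _ None) card_triangles_clique; congr (_ + _).
rewrite -[in RHS]card_nbhd_quasi_clique -cards_draws; apply: eq_card => e.
rewrite [in RHS]inE [in LHS]inE andbC; case: (boolP (_ \subset _)) => //= eN.
apply/idP/eqP => [/card_edge //|/eqP/cards2P[x [y [xy E]]]].
move: eN; rewrite E mem_edges subUset !sub1set !inE.
by case: x y xy {E} => [i|] [j|] //=; rewrite ?andbF.
Qed.

End Extremal.

Theorem theorem2p5 (n r : nat) (n_gt0 : 0 < n) (r_gt0 : 0 < r)
    (r_le : 'C(r, 2) <= n) (r_lt : n < 'C(r.+1, 2)) :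
  let t := n - 'C(r, 2) in
  (forall (T : finType) (G : sgraph T),
      #|edges G| = n -> #|triangles G| <= 'C(r, 3) + 'C(t, 2))
  /\ (exists (T : finType) (G : sgraph T),
      #|edges G| = n /\ #|triangles G| = 'C(r, 3) + 'C(t, 2)).
Proof.
move=> t; have nE : 'C(r, 2) + t = n by rewrite subnKC.
have t_lt_r : t < r by move: r_lt; rewrite -nE binS bin1 ltn_add2l.
split=> [T G cardG|]; first by apply: leq_card_triangles; rewrite ?nE.
exists (option 'I_r : finType), (quasi_clique r t).
by rewrite card_edges_quasi_clique ?card_triangles_quasi_clique // ltnW.
Qed.
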